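(* (Porada inequality.) Let $\gamma:J\to\mathbb F$ be bounded and satisfy the oscillatory condition $O_2$. Then $$\limsup_{|t|\to\infty}\|u(t)\|\le\|u+\gamma v\|_\infty\qquad\text{for all }u,v\in UC(J,X).$$ If instead of boundedness of $\gamma$ and $O_2$ one only assumes $\|\gamma\|_{S^1}<\infty$ and $\gamma\in MC_0(J,\mathbb F)$, then the inequality holds for all $u\in UC(J,X)$ and $v\in BUC(J,X)$.
   Context: $X\neq\{0\}$ is a Banach space over $\mathbb F\in\{\mathbb R,\mathbb C\}$; $J$ is $[\alpha,\infty)$, $(\alpha,\infty)$ ($\alpha\in\mathbb R$) or $\mathbb R$. $UC$, $BUC$: uniformly continuous, bounded uniformly continuous functions. $C_0(J,\mathbb F)$: uniformly continuous functions vanishing at infinity (as $t\to\infty$, and also as $t\to-\infty$ if $J=\mathbb R$). $\|f\|_\infty=\sup_{t\in J}\|f(t)\|\in[0,\infty]$. $\limsup_{|t|\to\infty}$ means $\limsup_{t\to\infty}$ if $J\ne\mathbb R$ and the maximum of the limsups as $t\to\pm\infty$ if $J=\mathbb R$. Condition $O_2$: for each sequence $(t_m)_{m\in\mathbb N}$ in $J$ with $|t_m|\to\infty$ there exists $\rho_0>0$ such that for every $n\in\mathbb N$ and every $\delta>0$ there exist $m\in\mathbb N$ with $m\ge n$ and $s_+,s_-\in[t_m,t_m+\delta]$ with $|\gamma(s_+)|\ge\rho_0$ and $|\gamma(s_+)+\gamma(s_-)|\le\delta$. $L^1_{\rm loc}(J,\mathbb F)$: functions integrable over every compact interval contained in $J$;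 $\|\gamma\|_{S^1}=\sup_{t\in J}\int_t^{t+1}|\gamma(s)|\,ds$ for $\gamma\in L^1_{\rm loc}(J,\mathbb F)$. $(M_h\gamma)(t)=\frac1h\int_0^h\gamma(t+s)\,ds$; $\gamma\in MC_0(J,\mathbb F)$ means $\gamma\in L^1_{\rm loc}(J,\mathbb F)$ and $M_h\gamma\in C_0(J,\mathbb F)$ for all $h>0$. *)

(* Defs.v *)
From HB Require Import structures.
From mathcomp Require Import all_boot all_order all_algebra.
From mathcomp Require Import all_classical all_reals all_analysis.
From mathcomp Require Import complex.

Set Implicit Arguments.
Unset Strict Implicit.
Unset Printing Implicit Defensive.

Import Order.TTheory GRing.Theory Num.Theory.
Import numFieldNormedType.Exports.

Local Open Scope classical_set_scope.
Local Open Scope ring_scope.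

Inductive scalars := RealScalars | ComplexScalars.

Definition scalar_field (R : realType) (s : scalars) : numFieldType :=
  match s with
  | RealScalars => R : numFieldType
  | ComplexScalars => R[i] : numFieldType
  end.

Definition scalar_re (R : realType) (s : scalars) : scalar_field R s -> R :=
  match s with
  | RealScalars => fun z => z
  | ComplexScalars => fun z => complex.Re z
  end.

Definition scalar_im (R : realType) (s : scalars) : scalar_field R s -> R :=
  match s with
  | RealScalars => fun=> 0
  | ComplexScalars => fun z => complex.Im z
  end.

(* The scalar a + i b; in the real case b is ignored, and it is 0 wherever
   this function is used below. *)
Definition scalar_of (R : realType) (s : scalars) : R -> R -> scalar_field R s :=
  match s with
  | RealScalars => fun a _ => a
  | ComplexScalars => fun a b => Complex a b
  end.

(* The library norm of a space over K takes values in K; for K = R[i] this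
   norm is a complex number with zero imaginary part. *)
Definition rnorm (R : realType) (s : scalars)
    (V : normedModType (scalar_field R s)) (x : V) : R :=
  scalar_re `|x|.

Inductive half_line (R : realType) :=
  | ClosedRay of R
  | OpenRay of R
  | WholeLine.
Arguments WholeLine {R}.

Definition half_line_set (R : realType) (J : half_line R) : set R :=
  match J with
  | ClosedRay a => `[a, +oo[
  | OpenRay a => `]a, +oo[
  | WholeLine => setT
  end.

Coercion half_line_set : half_line >-> set.

(* A function on J is represented by a total function on R; none of the notions
   below depends on its values outside J. *)
Section FunctionsOnHalfLines.
Variables (R : realType) (s : scalars) (J : half_line R).
Local Notation K := (scalar_field R s).
(* The library's [lebesgue_measure] lives on the Borel sigma-algebra; functions
   here are not identified up to null sets, so Lebesgue measurability requires
   the completed measure. *)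
Local Notation mu := (@completed_lebesgue_measure R).

Definition UC (V : normedModType K) (f : R -> V) : Prop :=
  unif_continuous (f : subspace J -> V).

Definition bounded_on (V : normedModType K) (f : R -> V) : Prop :=
  [bounded f t | t in (J : set R)].

Definition BUC (V : normedModType K) (f : R -> V) : Prop :=
  UC f /\ bounded_on f.

Definition vanishes_at_infinity (V : normedModType K) (f : R -> V) : Prop :=
  match J with
  | WholeLine => f t @[t --> +oo] --> (0 : V) /\ f t @[t --> -oo] --> (0 : V)
  | _ => f t @[t --> +oo] --> (0 : V)
  end.

Definition C0 (V : normedModType K) (f : R -> V) : Prop :=
  UC f /\ vanishes_at_infinity f.

Definition sup_norm (V : normedModType K) (f : R -> V) : \bar R :=
  ereal_sup [set (rnorm (f t))%:E | t in (J : set R)].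

Definition limsup_infinity (V : normedModType K) (f : R -> V) : \bar R :=
  let N t := (rnorm (f t))%:E in
  match J with
  | WholeLine => Order.max (limf_esup N +oo) (limf_esup N -oo)
  | _ => limf_esup N +oo
  end.

Definition O2 (gamma : R -> K^o) : Prop :=
  forall t_ : nat -> R,
    (forall m, (J : set R) (t_ m)) -> `|t_ m| @[m --> \oo] --> +oo ->
    exists2 rho0 : R, 0 < rho0 &
      forall (n : nat) (delta : R), 0 < delta ->
        exists (m : nat) (sp sm : R),
          [/\ (n <= m)%N,
              sp \in `[t_ m, t_ m + delta],
              sm \in `[t_ m, t_ m + delta],
              rho0 <= rnorm (gamma sp) &
              rnorm (gamma sp + gamma sm) <= delta].

Definition L1loc (gamma : R -> K^o) : Prop :=
  forall a b : R, `[a, b] `<=` (J : set R) ->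
    mu.-integrable `[a, b] (fun t => (scalar_re (gamma t))%:E) /\
    mu.-integrable `[a, b] (fun t => (scalar_im (gamma t))%:E).

Definition S1_norm (gamma : R -> K^o) : \bar R :=
  ereal_sup
    [set (\int[mu]_(x in `[t, (t + 1)%R]) (rnorm (gamma x))%:E)%E | t in (J : set R)].

Definition scalar_integral (D : set R) (f : R -> K^o) : K^o :=
  scalar_of s (\int[mu]_(x in D) scalar_re (f x))
              (\int[mu]_(x in D) scalar_im (f x)).

Definition mean (h : R) (gamma : R -> K^o) : R -> K^o :=
  fun t => scalar_of s h^-1 0 * scalar_integral `[0, h] (fun x => gamma (t + x)).

Definition MC0 (gamma : R -> K^o) : Prop :=
  L1loc gamma /\ forall h : R, 0 < h -> C0 (mean h gamma).

End FunctionsOnHalfLines.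

(* Main.v *)
Require Import Defs.
From HB Require Import structures.
From mathcomp Require Import all_boot all_order all_algebra.
From mathcomp Require Import all_classical all_reals all_analysis.
From mathcomp Require Import measurable_realfun complex ring lra.
Import Order.TTheory GRing.Theory Num.Theory.
Import numFieldNormedType.Exports.
Local Open Scope classical_set_scope.
Local Open Scope ring_scope.

Set Implicit Arguments.
Unset Strict Implicit.
Unset Printing Implicit Defensive.

(** Both inequalities are proved by contradiction.  If the limsup exceeds the
    supremum [S] of [|u + gamma v|], there are a real [c > S] and points [t] of
    [J] with [|t|] arbitrarily large and [|u t| > c] ([limsup_infinity_le]).  A
    contradiction follows as soon as [|u t| <= S + O(e)] at such points, because
    near [t] the oscillation of [gamma] cancels the term [gamma v].

    Under [O2] the cancellation takes two points [sp], [sm] close to [t] at which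
    the values of [gamma] are almost opposite.  Adding [u + gamma v] at these two
    points gives [2 u(t)], up to the uniform continuity of [u] and [v] and up to
    [(gamma sp + gamma sm) v(sp)].  Although [v] may be unbounded, [v(sp)] is
    under control: [|gamma sp|] is bounded below, so [|v(sp)|] is at most a
    multiple of [S + |u(sp)|].

    In the second case the cancellation comes from the small means of [gamma].
    An interval [t, t + h] on which [u] is almost constant is cut into [N]
    pieces so short that [v] varies by at most [w] on each of them.  On a piece
    [a, a + d], freezing [u] at [t] and [v] at [a] gives
    [|u t + gamma v(a)| <= S + e + w |gamma|]; integrating and using that the
    mean of [gamma] over the piece tends to 0 bounds [d |u t|]
    ([rnorm_local_average]).  Summing over the pieces costs
    [w] times the integral of [|gamma|] over [t, t + h], which the Stepanov norm
    bounds whatever [N] is, so [w] can be chosen first and [N] afterwards.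

    Two tools enter the second case.  The inequality
    [|(b - a) x + (\int gamma) y| <= \int |x + gamma y|] is reached
    without a vector-valued integral: a real functional on the span of the left-hand
    vector, [y] and [i y] that norms this vector and is dominated by the norm
    turns it into an inequality between scalar integrals
    ([supporting_functional], [rnorm_integral_affine]).  And the completed
    Lebesgue measure is invariant under translations ([integral_translation]),
    which rewrites the means of [gamma] as integrals over [t, t + h]. *)

(** * Real and complex scalars treated uniformly *)

Section Scalars.
Context {R : realType} {s : scalars}.
Local Notation K := (scalar_field R s).

Definition of_real (a : R) : K := scalar_of s a 0.

Lemma scalar_reD (k l : K) : scalar_re (k + l) = scalar_re k + scalar_re l.
Proof. by case: s k l => [|] //= [? ?] [? ?]. Qed.

Lemma scalar_imD (k l : K) : scalar_im (k + l) = scalar_im k + scalar_im l.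
Proof. by case: s k l => [k l|[? ?] [? ?]] //=; rewrite addr0. Qed.

Lemma of_real_is_zmod_morphism : zmod_morphism of_real.
Proof.
move=> a b; rewrite /of_real; case: s => //=.
by apply/eqP; rewrite eq_complex/= subr0 !eqxx.
Qed.

Lemma of_real_is_monoid_morphism : monoid_morphism of_real.
Proof.
split; first by rewrite /of_real; case: s.
move=> a b; rewrite /of_real; case: s => //=.
by apply/eqP; rewrite eq_complex/= !mulr0 mul0r subr0 addr0 !eqxx.
Qed.

HB.instance Definition _ :=
  GRing.isZmodMorphism.Build R K of_real of_real_is_zmod_morphism.
HB.instance Definition _ :=
  GRing.isMonoidMorphism.Build R K of_real of_real_is_monoid_morphism.

Lemma ler_of_real (a b : R) : (of_real a <= of_real b) = (a <= b).
Proof. by rewrite /of_real; case: s => //=; rewrite lecE/= eqxx. Qed.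

Lemma ltr_of_real (a b : R) : (of_real a < of_real b) = (a < b).
Proof. by rewrite /of_real; case: s => //=; rewrite ltcE/= eqxx. Qed.

Lemma of_realK (k : K) : 0 <= k -> of_real (scalar_re k) = k.
Proof.
rewrite /of_real; case: s k => //= -[a b].
by rewrite lecE/= => /andP[/eqP -> _].
Qed.

Lemma scalar_re_of_real (a : R) : scalar_re (of_real a) = a.
Proof. by rewrite /of_real; case: s. Qed.

Lemma normr_of_real (a : R) : `|of_real a| = of_real `|a|.
Proof.
rewrite /of_real; case: s => //=.
by rewrite normc_def/= expr0n/= addr0 sqrtr_sqr.
Qed.

(** The imaginary unit, which collapses to 0 over the reals; with this convention
    [scalar_of_split] holds for both scalar fields. *)
Definition unit_im : K := scalar_of s 0 1.

Lemma scalar_of_split (a b : R) :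
  scalar_of s a b = of_real a + of_real b * unit_im.
Proof.
rewrite /of_real /unit_im; case: s => /=; first by rewrite mulr0 addr0.
apply/eqP; rewrite eq_complex/=.
by rewrite !(mulr0, mulr1, mul0r, subr0, addr0, add0r) !eqxx.
Qed.

Lemma scalar_reim (k : K) : scalar_of s (scalar_re k) (scalar_im k) = k.
Proof. by case: s k => //= -[]. Qed.

Lemma scalar_re_realM (a : R) (k : K) :
  scalar_re (of_real a * k) = a * scalar_re k.
Proof. by rewrite /of_real; case: s k => //= -[x y] /=; rewrite mul0r subr0. Qed.

Lemma scalar_im_realM (a : R) (k : K) :
  scalar_im (of_real a * k) = a * scalar_im k.
Proof.
by rewrite /of_real; case: s k => [k|[x y]] /=; rewrite ?mulr0// mul0r addr0.
Qed.

End Scalars.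

Section RealNorm.
Context {R : realType} {s : scalars}.
Local Notation K := (scalar_field R s).
Context {V : normedModType K}.
Implicit Types x y : V.

Lemma normr_rnorm x : `|x| = of_real (rnorm x).
Proof. by rewrite /rnorm of_realK. Qed.

Lemma rnorm_ge0 x : 0 <= rnorm x.
Proof. by rewrite -(@ler_of_real _ s) -normr_rnorm rmorph0. Qed.

Lemma ler_rnormD x y : rnorm (x + y) <= rnorm x + rnorm y.
Proof. by rewrite -(@ler_of_real _ s) rmorphD/= -!normr_rnorm ler_normD. Qed.

Lemma rnormN x : rnorm (- x) = rnorm x.
Proof. by rewrite /rnorm normrN. Qed.

Lemma ler_rnormB x y : rnorm (x - y) <= rnorm x + rnorm y.
Proof. by rewrite -(rnormN y); exact: ler_rnormD. Qed.

Lemma rnormZ (k : K) x : rnorm (k *: x) = rnorm (k : K^o) * rnorm x.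
Proof.
apply: (can_inj (@scalar_re_of_real R s)); rewrite rmorphM/=.
by rewrite -!normr_rnorm normrZ /rnorm of_realK.
Qed.

Lemma rnormZr (a : R) x : rnorm (of_real a *: x) = `|a| * rnorm x.
Proof. by rewrite rnormZ {1}/rnorm /= normr_of_real scalar_re_of_real. Qed.

End RealNorm.

Section ScalarModulus.
Context {R : realType} {s : scalars}.
Local Notation K := (scalar_field R s).

Lemma rnorm_sqrt (k : K^o) :
  rnorm k = Num.sqrt (scalar_re k ^+ 2 + scalar_im k ^+ 2).
Proof.
rewrite /rnorm; case: s k => [k|[a b]] /=; last by [].
by rewrite expr0n/= addr0 sqrtr_sqr.
Qed.

Lemma rnorm_le_reim (k : K^o) : rnorm k <= `|scalar_re k| + `|scalar_im k|.
Proof.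
rewrite rnorm_sqrt -[leRHS]ger0_norm ?addr_ge0// -sqrtr_sqr.
rewrite ler_wsqrtr// -!(real_normK (num_real (scalar_re k))).
rewrite -!(real_normK (num_real (scalar_im k))) sqrrD.
by rewrite lerD2r lerDl mulrn_wge0// mulr_ge0.
Qed.

Lemma integrable_rnorm d (T : measurableType d) (nu : {measure set T -> \bar R})
    (D : set T) (f : T -> K^o) : measurable D ->
  nu.-integrable D (fun x => (scalar_re (f x))%:E) ->
  nu.-integrable D (fun x => (scalar_im (f x))%:E) ->
  nu.-integrable D (fun x => (rnorm (f x))%:E).
Proof.
move=> mD ire iim.
have mre := measurable_int _ ire; have mim := measurable_int _ iim.
apply: (le_integrable mD _ _ (integrableD mD (integrable_abse ire)
  (integrable_abse iim))).
- apply/measurable_EFinP.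
  under eq_fun do rewrite rnorm_sqrt.
  apply: (measurableT_comp (f := @Num.sqrt R)).
    by apply: continuous_measurable_fun => x; exact: sqrt_continuous.
  by apply: measurable_funD; apply: measurable_funX; exact/measurable_EFinP.
- move=> x Dx /=; rewrite lee_fin ger0_norm ?rnorm_ge0//.
  by rewrite ger0_norm ?addr_ge0// rnorm_le_reim.
Qed.

End ScalarModulus.

(** * Translation invariance of the completed Lebesgue measure *)

Definition translate {R : realType} (t : R) (A : set R) : set R :=
  [set x | A (t + x)].

Section Translation.
Context {R : realType}.
Local Notation mu := (@completed_lebesgue_measure R).
Local Notation length_ext := (mu_ext (wlength (@idfun R))).
Local Notation lebesgueType := (caratheodory_type length_ext).

Lemma translateK (t : R) (A : set R) : translate (- t) (translate t A) = A.
Proof. by apply/seteqP; split => x /=; rewrite /translate/= addrA subrr add0r. Qed.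

Lemma translate_itvoc (t a b : R) :
  translate t `]a, b] = `](a - t), (b - t)]%classic.
Proof.
by apply/seteqP; split => x; rewrite /translate /= !in_itv/= ltrBlDl lerBrDl.
Qed.

Lemma wlength_translate (t : R) (A : set R) : ocitv A ->
  ocitv (translate t A) /\
  wlength idfun (translate t A) = wlength idfun A.
Proof.
move=> [[a b] _ <-] /=; rewrite translate_itvoc; split; first exact: is_ocitv.
by rewrite !wlength_itv/= !lte_fin ltrD2r -!EFinB opprB addrA subrK.
Qed.

(** Translating a cover by half-open intervals gives a cover of the same total
    length. *)
Lemma le_mu_ext_translate (t : R) (A : set R) :
  (length_ext (translate t A) <= length_ext A)%E.
Proof.
apply: le_ereal_inf_tmp => _ [C [mC AC] <-]; apply: ereal_inf_lbound.
exists (fun k => translate t (C k)).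
  split => [k|x Ax]; first by have [] := wlength_translate t (mC k).
  by have [k _ Ck] := AC _ Ax; exists k.
by apply: eq_eseriesr => k _; have [] := wlength_translate t (mC k).
Qed.

Lemma mu_ext_translate (t : R) (A : set R) :
  length_ext (translate t A) = length_ext A.
Proof.
apply/eqP; rewrite eq_le le_mu_ext_translate/=.
by rewrite -{1}(translateK t A) le_mu_ext_translate.
Qed.

(** Caratheodory's criterion only involves the outer measure, so translation
    invariance of the latter carries over to measurability. *)
Lemma measurable_translation (t : R) :
  measurable_fun [set: lebesgueType]
    ((fun x => t + x) : lebesgueType -> lebesgueType).
Proof.
move=> _ A mA; rewrite setTI; change (length_ext.-caratheodory A) in mA.
change (length_ext.-caratheodory (translate t A)) => B.
rewrite -(mu_ext_translate (- t) B) mA.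
rewrite -(mu_ext_translate t (_ `&` A)) -(mu_ext_translate t (_ `&` ~` A)).
by rewrite -[in RHS](translateK (- t) B) opprK.
Qed.

Let shift_by (t : R) : lebesgueType -> lebesgueType := fun x => t + x.

Let ge0_integral_translation (t : R) (D : set R) (f : R -> \bar R) :
  measurable (D : set lebesgueType) ->
  measurable_fun (D : set lebesgueType) f -> (forall x, 0 <= f x)%E ->
  (\int[mu]_(x in translate t D) f (t + x)%R = \int[mu]_(x in D) f x)%E.
Proof.
move=> mD mf f0.
transitivity (\int[pushforward mu (shift_by t)]_(x in D) f x)%E; last first.
  apply: eq_measure_integral; first exact: measurable_translation.
  by move=> mphi A mA _; exact: (mu_ext_translate t A).
by rewrite ge0_integral_pushforward//; exact: measurable_translation.
Qed.

Lemma integral_translation (t : R) (D : set R) (f : R -> \bar R) :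
  measurable (D : set lebesgueType) ->
  measurable_fun (D : set lebesgueType) f ->
  (\int[mu]_(x in translate t D) f (t + x)%R = \int[mu]_(x in D) f x)%E.
Proof.
move=> mD mf; rewrite [LHS]integralE [RHS]integralE.
congr (_ - _)%E.
  rewrite (funepos_comp f (shift_by t)).
  exact: (ge0_integral_translation t mD (measurable_funepos mf)).
rewrite (funeneg_comp f (shift_by t)).
exact: (ge0_integral_translation t mD (measurable_funeneg mf)).
Qed.

Lemma measurable_itv_lebesgue (i : interval R) :
  measurable ([set` i] : set lebesgueType).
Proof. by apply: sub_caratheodory; exact: measurable_itv. Qed.

Lemma completed_lebesgue_measureE (A : set R) : mu A = @lebesgue_measure R A.
Proof. by []. Qed.

Lemma integral_translation_itv (t h : R) (f : R -> \bar R) :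
  measurable_fun (`[t, t + h]%classic : set lebesgueType) f ->
  (\int[mu]_(x in `[0%R, h]) f (t + x)%R = \int[mu]_(x in `[t, (t + h)%R]) f x)%E.
Proof.
move=> mf; rewrite -(integral_translation t (measurable_itv_lebesgue _) mf).
congr integral; rewrite /translate; apply/seteqP; split => x /=; rewrite !in_itv/=;
  by rewrite lerDl lerD2l.
Qed.

End Translation.

(** * Integrals over compact intervals *)

Section LebesgueIntervals.
Context {R : realType}.
Local Notation mu := (@completed_lebesgue_measure R).
Local Notation lebesgueType := (caratheodory_type (mu_ext (wlength (@idfun R)))).

Lemma completed_lebesgue_measure_itvcc (a b : R) : a <= b ->
  mu `[a, b] = (b - a)%:E.
Proof.
move=> ab; rewrite completed_lebesgue_measureE lebesgue_measure_itv/= lte_fin.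
by case: ltgtP ab => // ->; rewrite subrr.
Qed.

Lemma integrable_cst_itvcc (a b c : R) : a <= b ->
  mu.-integrable `[a, b] (EFin \o cst c).
Proof.
move=> ab; have mI := measurable_itv_lebesgue `[a, b].
apply/integrableP; split; first exact: (measurable_cst c%:E).
have -> := integral_cst mu mI `|c|%:E.
rewrite [X in (_ * X)%E](_ : _ = (b - a)%:E) ?ltry//.
exact: completed_lebesgue_measure_itvcc.
Qed.

Lemma integrable_subitv (a b c d : R) (f : R -> \bar R) : a <= c -> d <= b ->
  mu.-integrable `[a, b] f -> mu.-integrable `[c, d] f.
Proof.
move=> ac db; apply: integrableS; try exact: measurable_itv_lebesgue.
by apply: subset_itvScc; rewrite bnd_simp.
Qed.

Lemma Rintegral_itvcc_split (a b c : R) (f : R -> R) : a <= b -> b <= c ->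
  mu.-integrable `[a, c] (EFin \o f) ->
  \int[mu]_(x in `[a, c]) f x =
  \int[mu]_(x in `[a, b]) f x + \int[mu]_(x in `[b, c]) f x.
Proof.
move=> ab bc fi.
have mI := @measurable_itv_lebesgue R.
have ibc : mu.-integrable `[b, c] (EFin \o f) by exact: integrable_subitv fi.
have acE : `[a, c]%classic = `[a, b]%classic `|` `]b, c]%classic :> set R.
  apply/seteqP; split => x /=; rewrite !in_itv/=.
    move=> /andP[-> ->]; rewrite andbT.
    by case: (leP x b) => _; [left|right].
  move=> [/andP[-> xb]|/andP[bx ->]]; first exact: le_trans xb bc.
  by rewrite andbT (le_trans ab (ltW bx)).
have bcE : `[b, c]%classic = [set b] `|` `]b, c]%classic :> set R.
  by rewrite setU1itv// bnd_simp.
have mb : measurable ([set b] : set lebesgueType).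
  by rewrite -set_itv1; exact: mI.
rewrite acE Rintegral_setU//; first last.
- apply/disj_setPS => x [] /=; rewrite !in_itv/= => /andP[_ xb] /andP[bx _].
  by move: (le_lt_trans xb bx); rewrite ltxx.
- by rewrite -acE.
congr (_ + _); rewrite bcE Rintegral_setU//; first last.
- apply/disj_setPS => x [] /= ->; rewrite !in_itv/= => /andP[].
  by rewrite ltxx.
- by rewrite -bcE.
rewrite [X in _ = X + _](_ : _ = 0) ?add0r// /Rintegral null_set_integral//=.
- have /integrableP[+ _] := ibc; apply: measurable_funS => //.
  by move=> x ->; rewrite /= in_itv/= lexx bc.
- by rewrite completed_lebesgue_measureE lebesgue_measure_set1.
Qed.

Lemma sum_Rintegral_itvcc (t delta : R) (n : nat) (f : R -> R) : 0 <= delta ->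
  mu.-integrable `[t, t + delta *+ n] (EFin \o f) ->
  \sum_(i < n)
    \int[mu]_(x in `[(t + delta *+ i)%R, (t + delta *+ i + delta)%R]) f x =
  \int[mu]_(x in `[t, (t + delta *+ n)%R]) f x.
Proof.
move=> d0; elim: n => [|n IHn] fi.
  rewrite big_ord0 mulr0n addr0 /Rintegral null_set_integral//.
  - exact: measurable_itv_lebesgue.
  - by move: fi; rewrite mulr0n addr0 => /integrableP[].
  - by apply: etrans (completed_lebesgue_measure_itvcc (lexx t)) _; rewrite subrr.
have tn : t <= t + delta *+ n by rewrite lerDl mulrn_wge0.
have nS : t + delta *+ n <= t + delta *+ n.+1 by rewrite lerD2l mulrS lerDr.
rewrite big_ord_recr/= (Rintegral_itvcc_split tn nS)//.
rewrite -IHn; first by rewrite -addrA -mulrSr.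
exact: integrable_subitv fi.
Qed.

End LebesgueIntervals.

(** * Norm of an integral *)

Section Supporting.
Context {R : realType} {s : scalars}.
Local Notation K := (scalar_field R s).
Local Notation mu := (@completed_lebesgue_measure R).
Context {V : normedModType K}.

(** The one-dimensional step of the Hahn-Banach theorem.  The source of the
    functional is a parameter space [T] rather than a subspace of [V], so that
    [emb] need not be injective and [y] may lie in its range. *)
Lemma dominated_extension (T : lmodType R) (emb : T -> V) (l : T -> R) (y : V) :
    (forall a z w, emb (a *: z + w) = of_real a *: emb z + emb w) ->
    (forall a z w, l (a *: z + w) = a * l z + l w) ->
    (forall z, l z <= rnorm (emb z)) ->
  exists beta, forall z b, l z + b * beta <= rnorm (emb z + of_real b *: y).
Proof.
move=> embL lL lb.
have embD z w : emb (z + w) = emb z + emb w.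
  by have := embL 1 z w; rewrite rmorph1 !scale1r.
have lD z w : l (z + w) = l z + l w.
  by have := lL 1 z w; rewrite mul1r scale1r.
have l0 : l 0 = 0 by have := lD 0 0; rewrite addr0; lra.
have emb0 : emb 0 = 0.
  by apply: (addrI (emb 0)); rewrite -embD !addr0.
have embZ a z : emb (a *: z) = of_real a *: emb z.
  by have := embL a z 0; rewrite emb0 !addr0.
have lZ a z : l (a *: z) = a * l z.
  by have := lL a z 0; rewrite l0 !addr0.
pose E := [set l z - rnorm (emb z - y) | z in setT].
have Eub w : ubound E (rnorm (emb w + y) - l w).
  move=> _ [z _ <-]; have := lb (z + w); rewrite lD embD.
  have := ler_rnormD (emb z - y) (emb w + y); rewrite addrACA addNr addr0.
  by lra.
pose beta := sup E.
have E0 : E !=set0 by exists (l 0 - rnorm (emb 0 - y)); exists 0.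
have betaU w : beta <= rnorm (emb w + y) - l w by exact: ge_sup.
have betaL z : l z - rnorm (emb z - y) <= beta.
  by apply: ub_le_sup; [exists (rnorm (emb 0 + y) - l 0)|exists z].
exists beta => z b.
have [b0|b0|->] := ltgtP b 0; last by rewrite rmorph0 scale0r mul0r !addr0.
- have c0 : 0 < - b by rewrite oppr_gt0.
  have -> : emb z + of_real b *: y
          = of_real (- b) *: (emb ((- b)^-1 *: z) - y).
    rewrite scalerBr embZ scalerA -rmorphM/= divff ?gt_eqF// rmorph1 scale1r.
    by rewrite rmorphN scaleNr opprK.
  rewrite rnormZr gtr0_norm//.
  have := betaL ((- b)^-1 *: z); rewrite lZ -(ler_pM2l c0) mulrBr mulrA.
  by rewrite divff ?gt_eqF// mul1r; lra.
- have -> : emb z + of_real b *: y = of_real b *: (emb (b^-1 *: z) + y).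
    by rewrite scalerDr embZ scalerA -rmorphM/= divff ?gt_eqF// rmorph1 scale1r.
  rewrite rnormZr gtr0_norm//.
  have := betaU (b^-1 *: z); rewrite lZ -(ler_pM2l b0) mulrBr mulrA.
  by rewrite divff ?gt_eqF// mul1r; lra.
Qed.

(** The functional norming [p] on the line through [p], extended first to [y] and
    then to [i y]; the real-linear form so obtained is the left-hand side. *)
Lemma supporting_functional (p y : V) : exists beta kappa : R,
  forall (a : R) (k : K), a * rnorm p + scalar_re k * beta + scalar_im k * kappa
    <= rnorm (of_real a *: p + k *: y).
Proof.
have [|||beta hbeta] := @dominated_extension R^o
    (fun a => of_real a *: p) (fun a => a * rnorm p) y.
- by move=> a z w /=; rewrite rmorphD rmorphM/= scalerDl scalerA.
- by move=> a z w /=; rewrite mulrDl mulrA.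
- by move=> z; rewrite rnormZr ler_wpM2r ?rnorm_ge0// ler_norm.
have [|||kappa hkappa] := @dominated_extension (R^o * R^o)%type
    (fun z => of_real z.1 *: p + of_real z.2 *: y)
    (fun z => z.1 * rnorm p + z.2 * beta) (unit_im *: y).
- move=> a z w /=; rewrite !rmorphD !rmorphM/= !scalerDl !scalerDr !scalerA.
  by rewrite addrACA.
- by move=> a z w /=; rewrite !mulrDl mulrDr !mulrA addrACA.
- by move=> z; exact: hbeta.
exists beta, kappa => a k.
rewrite -[in k *: y](scalar_reim k) scalar_of_split scalerDl -scalerA addrA.
exact: (hkappa (a, scalar_re k) (scalar_im k)).
Qed.

Lemma scalar_re_integral (D : set R) (f : R -> K^o) :
  scalar_re (scalar_integral D f) = \int[mu]_(x in D) scalar_re (f x).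
Proof. by rewrite /scalar_integral; case: s f. Qed.

Lemma scalar_im_integral (D : set R) (f : R -> K^o) :
  scalar_im (scalar_integral D f) = \int[mu]_(x in D) scalar_im (f x).
Proof. by rewrite /scalar_integral; case: s f => //= f; rewrite /Rintegral integral0. Qed.

(** With [p] the vector on the left of the conclusion and [I] the integral of [f],
    [x + f t y = p / (b - a) + (f t - I / (b - a)) y].  The functional supporting
    the norm at [p] therefore bounds [g] below by an affine function of the real
    and imaginary parts of [f], whose integral is exactly [|p|]. *)
Lemma rnorm_integral_affine (a b : R) (f : R -> K^o) (g : R -> R) (x y : V) :
  a < b ->
  mu.-integrable `[a, b] (fun t => (scalar_re (f t))%:E) ->
  mu.-integrable `[a, b] (fun t => (scalar_im (f t))%:E) ->
  mu.-integrable `[a, b] (EFin \o g) ->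
  (forall t, a <= t <= b -> rnorm (x + f t *: y) <= g t) ->
  rnorm (of_real (b - a) *: x + scalar_integral `[a, b] f *: y)
    <= \int[mu]_(t in `[a, b]) g t.
Proof.
move=> ab ire iim ig fg.
set m := b - a; have m0 : 0 < m by rewrite subr_gt0.
set I := scalar_integral _ _; set p := _ + _.
have mI := measurable_itv_lebesgue `[a, b].
have [beta [kappa supp]] := supporting_functional p y.
pose c := m^-1 * (rnorm p - scalar_re I * beta - scalar_im I * kappa).
have lower t : `[a, b]%classic t ->
    c + scalar_re (f t) * beta + scalar_im (f t) * kappa <= g t.
  move=> /=; rewrite in_itv/= => tab; apply: le_trans (fg t tab).
  have -> : x + f t *: y = of_real m^-1 *: p + (f t + of_real (- m^-1) * I) *: y.
    rewrite /p scalerDr !scalerA -rmorphM/= mulVf ?gt_eqF// rmorph1 scale1r.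
    by rewrite -addrA -scalerDl rmorphN mulNr addrCA subrr addr0.
  apply: le_trans (supp _ _).
  rewrite scalar_reD scalar_imD scalar_re_realM scalar_im_realM /c.
  by rewrite le_eqVlt; apply/orP; left; apply/eqP; ring.
have muI : mu `[a, b] = m%:E by apply: completed_lebesgue_measure_itvcc; exact: ltW.
have ic := integrable_cst_itvcc c (ltW ab).
have ire' : mu.-integrable `[a, b] (EFin \o (fun t => scalar_re (f t) * beta)).
  exact: (integrableZr mI beta ire).
have iim' : mu.-integrable `[a, b] (EFin \o (fun t => scalar_im (f t) * kappa)).
  exact: (integrableZr mI kappa iim).
have ire1 : mu.-integrable `[a, b] (EFin \o (fun t => c + scalar_re (f t) * beta)).
  exact: (integrableD mI ic ire').
have iim1 : mu.-integrable `[a, b]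
    (EFin \o (fun t => c + scalar_re (f t) * beta + scalar_im (f t) * kappa)).
  exact: (integrableD mI ire1 iim').
apply: le_trans (le_Rintegral mI iim1 ig lower).
rewrite (RintegralD mI ire1 iim') (RintegralD mI ic ire').
rewrite (RintegralZr beta mI ire) (RintegralZr kappa mI iim).
rewrite (Rintegral_cst _ mI) [fine _](_ : _ = m); last exact: (congr1 fine muI).
rewrite -scalar_re_integral -scalar_im_integral -/I -/m /c.
rewrite mulrAC mulVf ?gt_eqF// mul1r.
by rewrite le_eqVlt; apply/orP; left; apply/eqP; ring.
Qed.
End Supporting.

(** * Limits at infinity on half-lines *)

Section HalfLines.
Context {R : realType} {s : scalars} (J : half_line R).
Local Notation K := (scalar_field R s).
Implicit Type V : normedModType K.

Lemma half_line_le (x y : R) : (J : set R) x -> x <= y -> (J : set R) y.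
Proof.
case: J => [a|a|] //=; rewrite !in_itv/= !andbT.
  exact: le_trans.
exact: lt_le_trans.
Qed.

Lemma half_line_subset (a b : R) : (J : set R) a -> `[a, b] `<=` (J : set R).
Proof. by move=> Ja x /=; rewrite in_itv/= => /andP[ax _]; exact: half_line_le ax. Qed.

Lemma half_line_neq0 : (J : set R) !=set0.
Proof.
case: J => [a|a|] /=; [exists a|exists (a + 1)|exists 0] => //=.
  by rewrite in_itv/= lexx.
by rewrite in_itv/= andbT ltrDl.
Qed.

(** The non-strict [|x - y| <= d] lets the modulus be applied at both endpoints of
    a closed interval of length [d]. *)
Lemma UC_modulus V (f : R -> V) : UC J f -> forall e : R, 0 < e ->
  exists2 d : R, 0 < d & forall x y, (J : set R) x -> (J : set R) y ->
    `|x - y| <= d -> rnorm (f x - f y) < e.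
Proof.
move=> fuc e e0.
have e0' : 0 < of_real e :> K by rewrite -(rmorph0 of_real) ltr_of_real.
have : entourage [set xy : V * V | ball xy.1 (of_real e) xy.2].
  by rewrite -entourage_from_ballE; exists (of_real e).
move=> /fuc [/= E entE EJ].
move: entE; rewrite -entourage_from_ballE => -[d /= d0 dE].
exists (d / 2) => [|x y Jx Jy xy]; first exact: divr_gt0.
have /EJ/= : [set xy | xy.1 = xy.2 \/
    (J : set R) xy.1 /\ (J : set R) xy.2 /\ E xy] (x, y).
  right; split => //; split => //; apply: dE => /=.
  by rewrite -ball_normE/=; apply: le_lt_trans xy _; lra.
by rewrite -ball_normE/= normr_rnorm ltr_of_real.
Qed.

Lemma sup_norm_ub V (f : R -> V) (S : R) : (sup_norm J f <= S%:E)%E ->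
  forall t, (J : set R) t -> rnorm (f t) <= S.
Proof.
move=> fS t Jt; rewrite -lee_fin; apply: le_trans fS.
by apply: ereal_sup_ubound; exists t.
Qed.

Lemma limsup_infinity_far V (u : R -> V) (c : R) : (c%:E < limsup_infinity J u)%E ->
  forall A : R, exists t, [/\ (J : set R) t, A < `|t| & c < rnorm (u t)].
Proof.
pose N t := (rnorm (u t))%:E.
have far (F : set_system R) B : F B -> (c%:E < limf_esup N F)%E ->
    exists2 t, B t & c < rnorm (u t).
  move=> FB cN; have : (c%:E < ereal_sup (N @` B))%E.
    by apply: lt_le_trans cN _; apply: ereal_inf_lbound; exists B.
  by move=> /ereal_sup_gt[_ [t Bt <-]]; rewrite lte_fin; exists t.
have farR A : (c%:E < limf_esup N +oo%R)%E ->
    exists t, [/\ A < t & c < rnorm (u t)].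
  have FA : nbhs (+oo%R : set_system R) [set t | A < t].
    by apply: nbhs_pinfty_gt; rewrite num_real.
  by move=> /(far _ _ FA)[t At ct]; exists t.
rewrite /limsup_infinity -/N; case: J => [a|a|] /=.
- move=> h A; have [t [At ct]] := farR (Num.max a A) h.
  move: At; rewrite gt_max => /andP[/ltW at_ At].
  exists t; split => //; first by rewrite in_itv/= at_.
  exact: lt_le_trans (ler_norm t).
- move=> h A; have [t [At ct]] := farR (Num.max a A) h.
  move: At; rewrite gt_max => /andP[at_ At].
  exists t; split => //; first by rewrite in_itv/= at_.
  exact: lt_le_trans (ler_norm t).
- rewrite lt_max => /orP[h A|h A].
    have [t [At ct]] := farR A h; exists t; split => //.
    exact: lt_le_trans (ler_norm t).
  have FA : nbhs (-oo%R : set_system R) [set t | t < - A].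
    by apply: nbhs_ninfty_lt; rewrite num_real.
  have [t At ct] := far _ _ FA h.
  exists t; split => //; move: At => /=; rewrite ltrNr => At.
  by apply: lt_le_trans At _; rewrite -normrN ler_norm.
Qed.

(** The only property of the limsup that is used: to bound it by [sup_norm J w] it
    suffices to exclude points tending to infinity at which [|u|] stays above a
    level strictly larger than every value of [|w|]. *)
Lemma limsup_infinity_le V (u w : R -> V) :
    (forall S c : R, S < c -> (forall t, (J : set R) t -> rnorm (w t) <= S) ->
      ~ forall A : R, exists t,
          [/\ (J : set R) t, A < `|t| & c < rnorm (u t)]) ->
  (limsup_infinity J u <= sup_norm J w)%E.
Proof.
move=> noway; rewrite leNgt; apply/negP => wu.
have [S wS] : exists S, sup_norm J w = S%:E.
  have [t0 Jt0] := half_line_neq0.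
  have : ((rnorm (w t0))%:E <= sup_norm J w)%E.
    by apply: ereal_sup_ubound; exists t0.
  move: wu; case: (sup_norm J w) => [S| |] //; first by exists S.
  by rewrite ltNge leey.
have [c Sc cu] : exists2 c, S < c & (c%:E < limsup_infinity J u)%E.
  move: wu; rewrite wS; case: (limsup_infinity J u) => [r| |] //.
    rewrite lte_fin => Sr; exists ((S + r) / 2); first lra.
    by rewrite lte_fin; lra.
  by exists (S + 1); rewrite ?ltry//; lra.
apply: (noway _ _ Sc); last exact: limsup_infinity_far.
by apply: sup_norm_ub; rewrite wS.
Qed.

Lemma vanishes_far V (f : R -> V) : vanishes_at_infinity J f ->
  forall e : R, 0 < e -> exists A : R, forall t, (J : set R) t -> A < `|t| ->
    rnorm (f t) < e.
Proof.
move=> f0 e e0.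
have e0' : 0 < of_real e :> K by rewrite -(rmorph0 of_real) ltr_of_real.
have farR : f t @[t --> +oo] --> (0 : V) ->
    exists A, forall t, A < t -> rnorm (f t) < e.
  move=> /cvgr0_norm_lt/(_ _ e0')[A [_ Af]]; exists A => t At.
  by rewrite -(@ltr_of_real _ s) -normr_rnorm; exact: Af.
move: f0; rewrite /vanishes_at_infinity; case: J => [a|a|] /=.
- move=> /farR[A Af]; exists (Num.max A (- a)) => t; rewrite in_itv/= andbT.
  move=> at_; rewrite gt_max => /andP[At aNt]; apply: Af.
  move: aNt At; case: (ltrP t 0) => t0; last by rewrite ger0_norm.
  by rewrite ltr0_norm//; lra.
- move=> /farR[A Af]; exists (Num.max A (- a)) => t; rewrite in_itv/= andbT.
  move=> at_; rewrite gt_max => /andP[At aNt]; apply: Af.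
  move: aNt At; case: (ltrP t 0) => t0; last by rewrite ger0_norm.
  by rewrite ltr0_norm//; lra.
- move=> [/farR[A Af] /cvgr0_norm_lt/(_ _ e0')[B [_ Bf]]].
  exists (Num.max A (- B)) => t _; rewrite gt_max => /andP[At Bt].
  have [t0|t0] := ltrP t 0; last by apply: Af; rewrite -(ger0_norm t0).
  rewrite -(@ltr_of_real _ s) -normr_rnorm; apply: Bf.
  by move: Bt; rewrite ltr0_norm// ltrN2.
Qed.

End HalfLines.

(** * Bounded multipliers under the oscillation condition *)

Section BoundedMultiplier.
Context {R : realType} {s : scalars} (J : half_line R).
Local Notation K := (scalar_field R s).

Lemma bounded_rnorm (V : normedModType K) (f : R -> V) : bounded_on J f ->
  exists2 M : R, 0 < M & forall t, (J : set R) t -> rnorm (f t) <= M.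
Proof.
move=> [M0 [M0r fM]]; have M1 : M0 < `|M0| + 1.
  by apply: le_lt_trans (real_ler_norm M0r) _; rewrite ltrDl.
exists (scalar_re (`|M0| + 1 : K)).
  by rewrite -(@ltr_of_real _ s) of_realK ?addr_ge0// rmorph0 ltr_wpDl.
move=> t Jt; rewrite -(@ler_of_real _ s) -normr_rnorm of_realK ?addr_ge0//.
exact: fM M1 _ Jt.
Qed.

Lemma rnorm_paired_scale (V : normedModType K) (k l : K) (x y : V) :
  rnorm (k *: x + l *: y) <=
  rnorm (k + l : K^o) * rnorm x + rnorm (l : K^o) * rnorm (y - x).
Proof.
have -> : k *: x + l *: y = (k + l) *: x + l *: (y - x).
  by rewrite scalerDl scalerBr addrACA subrr addr0.
by rewrite -!rnormZ ler_rnormD.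
Qed.

Lemma porada_O2 (X : normedModType K) (gamma : R -> K^o) :
  bounded_on J gamma -> O2 J gamma ->
  forall u v : R -> X, UC J u -> UC J v ->
    (limsup_infinity J u <= sup_norm J (fun t => u t + gamma t *: v t)%R)%E.
Proof.
move=> /bounded_rnorm[M M0 gM] gO2 u v uUC vUC.
apply: limsup_infinity_le => S c Sc wS far.
have [t_ t_P] := choice (fun m : nat => far m%:R).
have t_oo : `|t_ m| @[m --> \oo] --> +oo.
  apply: (ger_cvgy _ cvgr_idn); near=> m.
  by have [_ /ltW] := t_P m.
have [m|rho rho0 osc] := gO2 t_ _ t_oo; first by have [] := t_P m.
have S0 : 0 <= S.
  by have [t Jt] := half_line_neq0 J; apply: le_trans (wS t Jt); exact: rnorm_ge0.
pose k := rho^-1; have k0 : 0 < k by rewrite invr_gt0.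
(* The final estimate leaves [2 (c - S) <= e Q] with this [Q]; hence [e] is chosen
   with [e Q <= c - S], and [e Q <= 1] keeps [e] and [e k] below 1. *)
pose Q := 1 + k + c * k + 2 + M + (S + 1) * k.
have ck0 : 0 < c * k by rewrite mulr_gt0//; lra.
have Sk0 : 0 < (S + 1) * k by rewrite mulr_gt0//; lra.
have Q0 : 0 < Q by rewrite /Q; lra.
pose e := Num.min 1 (c - S) / Q.
have m0 : 0 < Num.min 1 (c - S) by rewrite lt_min ltr01/=; lra.
have e0 : 0 < e by rewrite divr_gt0.
have eQ : e * Q <= 1 /\ e * Q <= c - S.
  by rewrite /e mulfVK ?gt_eqF// !ge_min !lexx orbT.
have [du du0 uP] := UC_modulus uUC e0.
have [dv dv0 vP] := UC_modulus vUC e0.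
pose d := Num.min (Num.min du dv) e.
have d0 : 0 < d by rewrite !lt_min du0 dv0.
have [m [sp [sm [_ sp_in sm_in gsp gpm]]]] := osc 0%N d d0.
have [Jt _ ct] := t_P m; set t := t_ m in sp_in sm_in Jt ct *.
have [ddu ddv de] : [/\ d <= du, d <= dv & d <= e].
  by rewrite /d !ge_min !lexx !orbT.
move: sp_in sm_in; rewrite !in_itv/= => /andP[tsp spd] /andP[tsm smd].
have Jsp := half_line_le Jt tsp; have Jsm := half_line_le Jt tsm.
have utsp : rnorm (u t - u sp) < e by apply: uP => //; rewrite ler_norml; lra.
have utsm : rnorm (u t - u sm) < e by apply: uP => //; rewrite ler_norml; lra.
have vsms : rnorm (v sm - v sp) < e by apply: vP => //; rewrite ler_norml; lra.
have wsp := wS _ Jsp; have wsm := wS _ Jsm; have gsm := gM _ Jsm.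
set a := rnorm (u t) in ct *.
(* The lower bound on [|gamma sp|] replaces boundedness of [v]. *)
have vsp : rnorm (v sp) <= (S + a + e) * k.
  rewrite ler_pdivlMr//.
  have : rnorm (u sp) <= a + e.
    have -> : u sp = u t - (u t - u sp) by rewrite subKr.
    by apply: le_trans (ler_rnormB _ _) _; rewrite lerD2l ltW.
  have : rnorm (gamma sp *: v sp) <= S + rnorm (u sp).
    rewrite -[gamma sp *: v sp](addKr (u sp)) addrC.
    exact: le_trans (ler_rnormB _ _) (lerD wsp (lexx _)).
  have : rnorm (v sp) * rho <= rnorm (gamma sp *: v sp).
    by rewrite rnormZ mulrC ler_wpM2r// rnorm_ge0.
  by lra.
have twice : 2 * a <= 2 * e + 2 * S + (d * rnorm (v sp) + M * e).
  have -> : 2 * a = rnorm (u t + u t).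
    have -> : u t + u t = of_real (1 + 1) *: u t.
      by rewrite rmorphD rmorph1 scalerDl scale1r.
    by rewrite rnormZr ger0_norm.
  have -> : u t + u t = (u t - u sp) + (u t - u sm) +
     ((u sp + gamma sp *: v sp) + (u sm + gamma sm *: v sm)
      - (gamma sp *: v sp + gamma sm *: v sm)).
    by rewrite [X in _ = _ + (X - _)]addrACA addrK [X in _ = X + _]addrACA -opprD subrK.
  have h1 := ler_rnormD (u t - u sp) (u t - u sm).
  have h2 := ler_rnormD (u sp + gamma sp *: v sp) (u sm + gamma sm *: v sm).
  have h3 : rnorm (gamma sp *: v sp + gamma sm *: v sm) <=
      d * rnorm (v sp) + M * e.
    apply: le_trans (rnorm_paired_scale _ _ _ _) _.
    by rewrite lerD ?ler_wpM2r ?ler_pM ?rnorm_ge0// ltW.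
  apply: le_trans (ler_rnormD _ _) _.
  have := ler_rnormB ((u sp + gamma sp *: v sp) + (u sm + gamma sm *: v sm))
      (gamma sp *: v sp + gamma sm *: v sm).
  by lra.
have dv_le : d * rnorm (v sp) <= e * ((S + a + e) * k).
  by rewrite ler_pM ?rnorm_ge0// ltW.
have [eQ1 eQ2] := eQ.
have e1 : e <= 1 by move: eQ1; apply: le_trans; rewrite ler_peMr ?ltW// /Q; lra.
have ek1 : e * k <= 1.
  by move: eQ1; apply: le_trans; rewrite ler_pM2l// /Q; lra.
(* [u] may be unbounded: the terms in [a] on the right are absorbed on the left,
   and only then is [a] replaced by its lower bound [c]. *)
have : (2 - e * k) * c <= (2 - e * k) * a by rewrite ler_wpM2l ?ltW//; lra.
have : e * e * k <= e * k.
  by rewrite ler_wpM2r ?(ltW k0)// ler_piMl// ltW.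
move: eQ2; rewrite /Q.
have : 0 < e * k by rewrite mulr_gt0.
nra.
Unshelve. all: by end_near. Qed.

End BoundedMultiplier.

(** * Stepanov-bounded multipliers with vanishing means *)

Section StepanovMultiplier.
Context {R : realType} {s : scalars} (J : half_line R).
Local Notation K := (scalar_field R s).
Local Notation mu := (@completed_lebesgue_measure R).
Implicit Types (V : normedModType K) (gamma : R -> K^o).

Lemma mean_interval (h t : R) gamma :
  mu.-integrable `[t, t + h] (fun x => (scalar_re (gamma x))%:E) ->
  mu.-integrable `[t, t + h] (fun x => (scalar_im (gamma x))%:E) ->
  mean h gamma t = of_real h^-1 * scalar_integral `[t, t + h] gamma.
Proof.
move=> /integrableP[mre _] /integrableP[mim _].
rewrite /mean /scalar_integral /Rintegral.
have -> := integral_translation_itv mre.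
by have -> := integral_translation_itv mim.
Qed.

Lemma L1loc_rnorm gamma (a b : R) : L1loc J gamma -> (J : set R) a ->
  mu.-integrable `[a, b] (EFin \o (fun x => rnorm (gamma x))).
Proof.
move=> gL Ja; have [ire iim] := gL a b (half_line_subset Ja).
exact: integrable_rnorm (measurable_itv_lebesgue _) ire iim.
Qed.

Lemma S1_norm_Rintegral gamma : (S1_norm J gamma < +oo)%E -> L1loc J gamma ->
  exists2 G : R, 0 <= G & forall t h, (J : set R) t -> 0 <= h <= 1 ->
    \int[mu]_(x in `[t, (t + h)%R]) rnorm (gamma x) <= G.
Proof.
move=> gS gL; exists (fine (S1_norm J gamma)).
  apply: fine_ge0; have [t Jt] := half_line_neq0 J.
  apply: (@le_trans _ _ (\int[mu]_(x in `[t, (t + 1)%R]) (rnorm (gamma x))%:E)%E).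
    by apply: integral_ge0 => x _; rewrite lee_fin rnorm_ge0.
  by apply: ereal_sup_ubound; exists t.
move=> t h Jt /andP[h0 h1].
have i1 := L1loc_rnorm (t + 1) gL Jt.
have Jth : (J : set R) (t + h) by apply: half_line_le Jt _; rewrite lerDl.
apply: (@le_trans _ _ (\int[mu]_(x in `[t, (t + 1)%R]) rnorm (gamma x))).
  have [tth tht1] : t <= t + h /\ t + h <= t + 1 by rewrite lerDl lerD2l.
  rewrite (Rintegral_itvcc_split tth tht1 i1) lerDl.
  by apply: Rintegral_ge0 => x _; exact: rnorm_ge0.
have le_S : (\int[mu]_(x in `[t, (t + 1)%R]) (rnorm (gamma x))%:E <= S1_norm J gamma)%E.
  by apply: ereal_sup_ubound; exists t.
have ge_0 : (0 <= \int[mu]_(x in `[t, (t + 1)%R]) (rnorm (gamma x))%:E)%E.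
  by apply: integral_ge0 => x _; rewrite lee_fin rnorm_ge0.
rewrite /Rintegral fine_le//.
- by rewrite ge0_fin_numE//; exact: le_lt_trans gS.
- by rewrite ge0_fin_numE//; exact: le_trans le_S.
Qed.

(** Freezing [u] at [x] and [v] at its value in [a] changes [u + gamma v] by at most
    [e + w |gamma|]; the integral of the frozen function over the interval is
    [d (x + mean d gamma a * v a)]. *)
Lemma rnorm_local_average (X : normedModType K) gamma (u v : R -> X) (x : X)
    (a d S e w : R) :
  L1loc J gamma -> (J : set R) a -> 0 < d ->
  (forall r, a <= r <= a + d -> rnorm (u r + gamma r *: v r) <= S) ->
  (forall r, a <= r <= a + d -> rnorm (x - u r) <= e) ->
  (forall r, a <= r <= a + d -> rnorm (v a - v r) <= w) ->
  d * rnorm x <= d * (S + e)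
    + w * \int[mu]_(r in `[a, (a + d)%R]) rnorm (gamma r)
    + d * (rnorm (mean d gamma a) * rnorm (v a)).
Proof.
move=> gL Ja d0 uvS xu vw.
have ad : a < a + d by rewrite ltrDl.
have adE : a + d - a = d by rewrite addrAC subrr add0r.
have mI := measurable_itv_lebesgue `[a, (a + d)%R].
have [ire iim] := gL a (a + d) (half_line_subset Ja).
have iabs := L1loc_rnorm (a + d) gL Ja.
have icst := integrable_cst_itvcc (S + e) (ltW ad).
have iw : mu.-integrable `[a, a + d] (EFin \o (fun r => w * rnorm (gamma r))).
  exact: (integrableZl mI w iabs).
have ig : mu.-integrable `[a, a + d]
    (EFin \o (fun r => (S + e) + w * rnorm (gamma r))).
  exact: (integrableD mI icst iw).
have pointwise r : a <= r <= a + d ->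
    rnorm (x + gamma r *: v a) <= S + e + w * rnorm (gamma r).
  move=> ard.
  have -> : x + gamma r *: v a =
      (u r + gamma r *: v r) + ((x - u r) + gamma r *: (v a - v r)).
    by rewrite scalerBr addrACA !subrKC.
  rewrite -(addrA S e); apply: le_trans (ler_rnormD _ _) (lerD (uvS _ ard) _).
  apply: le_trans (ler_rnormD _ _) (lerD (xu _ ard) _).
  by rewrite rnormZ mulrC ler_wpM2r ?rnorm_ge0 ?vw.
have := rnorm_integral_affine ad ire iim ig pointwise.
rewrite (RintegralD mI icst iw) (RintegralZl w mI iabs) (Rintegral_cst _ mI).
have -> : fine (mu `[a, a + d]) = d.
  by have /(congr1 fine) := completed_lebesgue_measure_itvcc (ltW ad); rewrite adE.
have -> : scalar_integral `[a, a + d] gamma = of_real d * mean d gamma a.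
  by rewrite (mean_interval ire iim) mulrA -rmorphM/= divff ?gt_eqF// rmorph1 mul1r.
rewrite adE -scalerA -scalerDr rnormZr gtr0_norm// [_ * d]mulrC => jensen.
rewrite -lerBlDr -mulrBr; apply: le_trans jensen; rewrite ler_pM2l// -rnormZ.
rewrite lerBlDr -{1}[x](addrK (mean d gamma a *: v a)).
exact: ler_rnormB.
Qed.

Lemma porada_MC0 (X : normedModType K) gamma :
  (S1_norm J gamma < +oo)%E -> MC0 J gamma ->
  forall u v : R -> X, UC J u -> BUC J v ->
    (limsup_infinity J u <= sup_norm J (fun t => u t + gamma t *: v t)%R)%E.
Proof.
move=> gS [gL gM] u v uUC [vUC /bounded_rnorm[B B0 vB]].
have [G G0 gG] := S1_norm_Rintegral gS gL.
apply: limsup_infinity_le => S c Sc wS far.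
pose e := (c - S) / 4; have e0 : 0 < e by rewrite /e; lra.
have [du du0 uP] := UC_modulus uUC e0.
pose h := Num.min 1 du; have h0 : 0 < h by rewrite lt_min ltr01.
have [h1 hdu] : h <= 1 /\ h <= du by rewrite /h !ge_min !lexx orbT.
(* [w] depends on [h] but not on the number of pieces; the [+ 1] covers [G = 0]. *)
pose w := e * h / (G + 1).
have G1 : 0 < G + 1 by lra.
have w0 : 0 < w by rewrite /w divr_gt0// mulr_gt0.
have [dv dv0 vP] := UC_modulus vUC w0.
pose N := (Num.bound (h / dv)).+1.
have N0 : 0 < N%:R :> R by rewrite ltr0n.
pose d := h / N%:R.
have d0 : 0 < d by rewrite divr_gt0.
have ddv : d <= dv.
  rewrite /d ler_pdivrMr// mulrC -ler_pdivrMr// ltW//.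
  have : h / dv < (Num.bound (h / dv))%:R.
    by apply: archi_boundP; rewrite divr_ge0// ltW.
  by move/lt_le_trans; apply; rewrite ler_nat.
have dN : d *+ N = h by rewrite -mulr_natr /d divfK ?gt_eqF.
have [_ mean0] := gM d d0.
have [A meanA] := vanishes_far mean0 (divr_gt0 e0 B0).
(* As [h <= 1], all the points [t + d *+ i] stay beyond [A]. *)
have [t [Jt tA ct]] := far (A + 1).
pose p i := t + d *+ i.
have pt i : (i <= N)%N -> t <= p i <= t + h.
  move=> iN; rewrite /p lerDl lerD2l mulrn_wge0 ?(ltW d0)//= -dN -(subnK iN).
  by rewrite mulrnDr lerDr mulrn_wge0 ?(ltW d0).
have Jp i : (i <= N)%N -> (J : set R) (p i).
  by move=> /pt/andP[tp _]; exact: half_line_le Jt tp.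
pose q i := \int[mu]_(x in `[p i, (p i + d)%R]) rnorm (gamma x).
have piece i : (i < N)%N ->
    d * rnorm (u t) <= d * (S + e) + w * q i + d * e.
  move=> iN; have Jpi := Jp i (ltnW iN).
  have /andP[tpi pih] := pt i (ltnW iN).
  have pdh : p i + d <= t + h.
    by have := pt i.+1 iN; rewrite /p mulrSr addrA => /andP[].
  have est := @rnorm_local_average X gamma u v (u t) (p i) d S e w gL Jpi d0.
  apply: (le_trans (est _ _ _)) =>
    [r /andP[pir rpd]|r /andP[pir rpd]|r /andP[pir rpd]|].
  - by apply: wS; exact: half_line_le pir.
  - apply/ltW/uP => //; first exact: half_line_le pir.
    by clear -tpi pir rpd pdh hdu; rewrite ler_norml; lra.
  - apply/ltW/vP => //; first exact: half_line_le pir.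
    by clear -pir rpd ddv; rewrite ler_norml; lra.
  rewrite lerD2l ler_pM2l// -[e](@divfK _ B) ?gt_eqF//.
  apply: ler_pM; rewrite ?rnorm_ge0 ?vB//; apply/ltW/meanA => //.
  have pt0 : 0 <= p i - t by rewrite subr_ge0.
  have := ler_normB (p i) (p i - t); rewrite subKr (ger0_norm pt0).
  by clear -tA pih h1; lra.
have sumq : \sum_(i < N) q i <= G.
  rewrite sum_Rintegral_itvcc ?(ltW d0)//; last exact: L1loc_rnorm.
  by rewrite dN; apply: gG => //; rewrite h1 ltW.
have sum_le : h * rnorm (u t) <= h * (S + e) + w * \sum_(i < N) q i + h * e.
  have sum_cst (y : R) : \sum_(i < N) d * y = h * y.
    by rewrite sumr_const card_ord -mulrnAl dN.
  rewrite -!sum_cst mulr_sumr -!big_split/=.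
  by apply: ler_sum => i _; exact: piece.
have wG : w * G <= h * e.
  rewrite /w mulrAC ler_pdivrMr// [h * e]mulrC (ler_pM2l (mulr_gt0 e0 h0)).
  by rewrite lerDl.
have wq : w * \sum_(i < N) q i <= w * G by rewrite ler_pM2l.
have : h * rnorm (u t) <= h * (S + 3 * e).
  have -> : h * (S + 3 * e) = h * (S + e) + h * e + h * e by ring.
  by apply: le_trans sum_le _; rewrite lerD2r lerD2l (le_trans wq wG).
rewrite ler_pM2l//; move: ct; rewrite /e; clear -Sc; lra.
Qed.

End StepanovMultiplier.

Theorem proposition5p4 (R : realType) (s : scalars)
    (X : completeNormedModType (scalar_field R s)) (J : half_line R)
    (gamma : R -> (scalar_field R s)^o)
    (X_neq0 : exists x : X, x != 0) :
  (bounded_on J gamma -> O2 J gamma ->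
    forall u v : R -> X, UC J u -> UC J v ->
      (limsup_infinity J u <= sup_norm J (fun t => u t + gamma t *: v t)%R)%E) /\
  ((S1_norm J gamma < +oo)%E -> MC0 J gamma ->
    forall u v : R -> X, UC J u -> BUC J v ->
      (limsup_infinity J u <= sup_norm J (fun t => u t + gamma t *: v t)%R)%E).
Proof.
split; first exact: porada_O2.
exact: porada_MC0.
Qed.
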